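(* Over $\mathbf{RCA}_0$, the statement that every scattered CSC space that is $eT_2$ and $T_3$ effectively embeds into a linear order (with its order topology) implies arithmetic comprehension.
   Context: All notions are formalized in second order arithmetic. CSC space: a tuple $(X,(U_i)_{i\in\mathbb{N}},k)$ with $X\subseteq\mathbb{N}$, $(U_i)$ a sequence of subsets of $X$ such that every $x\in X$ lies in some $U_i$, and $k:X\times\mathbb{N}\times\mathbb{N}\to\mathbb{N}$ a partial function such that $x\in U_i\cap U_j$ implies $x\in U_{k(x,i,j)}\subseteq U_i\cap U_j$. A set $A\subseteq X$ is open if for all $x\in A$ there is $i$ with $x\in U_i\subseteq A$. A subspace $Y\subseteq X$ has basic open sets $U_i\cap Y$. For CSC spaces $(X,(U_i),k)$, $(Y,(V_i),k')$, $f:X\to Y$ is effectively continuous if there is $v:X\times\mathbb{N}\to\mathbb{N}$ such that whenever $f(x)\in V_j$, $x\in U_{v(x,j)}$ and $f(U_{v(x,j)})\subseteq V_j$. $f$ is an effective embedding if it is effectively continuous and there is $v:X\times\mathbb{N}\to\mathbb{N}$ such that whenever $x\in U_i$, $x\in f^{-1}(V_{v(x,i)})\subseteq U_i$. $T_0$: for distinct points some open set contains exactly one of them. Regular: whenever $x\in U_i$ there are open $V,W$ with $x\in V\subseteq X\setminus W\subseteq U_i$. $T_3$: $T_0$ and regular. $eT_2$: there are $H_0,H_1:X^2\to\mathbb{N}$ such that for distinct $x,y$: $x\in U_{H_0(x,y)}$, $y\in U_{H_1(x,y)}$, $U_{H_0(x,y)}\cap U_{H_1(x,y)}=\emptyset$.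 Scattered: every nonempty subspace has an isolated point. Order topology on a linear order $(L,<_L)$: basic open sets $]a,b[$ with $a,b\in L\cup\{-\infty,+\infty\}$, and $k(z,(a,b),(x,y))=(\max\{a,x\},\min\{b,y\})$. *)

(* Defs.v *)
Set Implicit Arguments.

(** * Second-order arithmetic *)

(** Henkin structures for the language L_2; equality of numbers is Leibniz
    equality, and equality of sets is not primitive. The numbers may be
    nonstandard, and [numset] need not contain every subset of [number]. *)
Record L2structure := {
  number : Type;
  numset : Type;
  zero : number;
  one : number;
  add : number -> number -> number;
  mul : number -> number -> number;
  lt : number -> number -> Prop;
  elem : number -> numset -> Prop
}.

Arguments zero {_}.
Arguments one {_}.
Arguments add {_} _ _.
Arguments mul {_} _ _.
Arguments lt {_} _ _.
Arguments elem {_} _ _.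

Declare Scope L2_scope.
Delimit Scope L2_scope with L2.
Open Scope L2_scope.
Notation "x ∈ X" := (elem x X) (at level 70, no associativity) : L2_scope.
Notation "x ∉ X" := (~ elem x X) (at level 70, no associativity) : L2_scope.
Infix "⊕" := add (at level 50, left associativity) : L2_scope.
Infix "⊗" := mul (at level 40, left associativity) : L2_scope.
Infix "≺" := lt (at level 70, no associativity) : L2_scope.

Inductive term : Type :=
| TVar (n : nat)
| TZero
| TOne
| TAdd (t u : term)
| TMul (t u : term).

(** The arithmetical formulas of L_2, i.e. those without set quantifiers; no
    others occur in the axiom schemes below. Number variables are de Bruijn
    indices; [FIn t k] says that [t] belongs to the [k]-th set variable, which
    is always free and thus acts as a set parameter. *)
Inductive formula : Type :=
| FEq (t u : term)
| FLt (t u : term)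
| FIn (t : term) (k : nat)
| FNot (p : formula)
| FAnd (p q : formula)
| FOr (p q : formula)
| FImp (p q : formula)
| FAll (p : formula)
| FEx (p : formula).

Definition scons (A : Type) (a : A) (e : nat -> A) (n : nat) : A :=
  match n with 0 => a | S m => e m end.

Fixpoint teval (M : L2structure) (e : nat -> number M) (t : term) : number M :=
  match t with
  | TVar n => e n
  | TZero => zero
  | TOne => one
  | TAdd t u => teval M e t ⊕ teval M e u
  | TMul t u => teval M e t ⊗ teval M e u
  end.

Fixpoint sat (M : L2structure) (s : nat -> numset M) (e : nat -> number M)
    (p : formula) : Prop :=
  match p with
  | FEq t u => teval M e t = teval M e u
  | FLt t u => teval M e t ≺ teval M e u
  | FIn t k => teval M e t ∈ s k
  | FNot p => ~ sat M s e p
  | FAnd p q => sat M s e p /\ sat M s e q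
  | FOr p q => sat M s e p \/ sat M s e q
  | FImp p q => sat M s e p -> sat M s e q
  | FAll p => forall x, sat M s (scons x e) p
  | FEx p => exists x, sat M s (scons x e) p
  end.

Fixpoint lift (t : term) : term :=
  match t with
  | TVar n => TVar (S n)
  | TZero => TZero
  | TOne => TOne
  | TAdd t u => TAdd (lift t) (lift u)
  | TMul t u => TMul (lift t) (lift u)
  end.

(** The bounded-quantifier formulas. Lifting the bound [t] expresses that the
    quantified variable does not occur in it. *)
Inductive Sigma00 : formula -> Prop :=
| S00_eq t u : Sigma00 (FEq t u)
| S00_lt t u : Sigma00 (FLt t u)
| S00_in t k : Sigma00 (FIn t k)
| S00_not p : Sigma00 p -> Sigma00 (FNot p)
| S00_and p q : Sigma00 p -> Sigma00 q -> Sigma00 (FAnd p q)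
| S00_or p q : Sigma00 p -> Sigma00 q -> Sigma00 (FOr p q)
| S00_imp p q : Sigma00 p -> Sigma00 q -> Sigma00 (FImp p q)
| S00_all t p : Sigma00 p -> Sigma00 (FAll (FImp (FLt (TVar 0) (lift t)) p))
| S00_ex t p : Sigma00 p -> Sigma00 (FEx (FAnd (FLt (TVar 0) (lift t)) p)).

Inductive Sigma01 : formula -> Prop :=
| S01_ex p : Sigma00 p -> Sigma01 (FEx p).

Inductive Pi01 : formula -> Prop :=
| P01_all p : Sigma00 p -> Pi01 (FAll p).

Record basic_axioms (M : L2structure) : Prop := {
  succ_neq0 : forall n : number M, n ⊕ one <> zero;
  succ_inj : forall m n : number M, m ⊕ one = n ⊕ one -> m = n;
  add_0 : forall m : number M, m ⊕ zero = m;
  add_succ : forall m n : number M, m ⊕ (n ⊕ one) = (m ⊕ n) ⊕ one;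
  mul_0 : forall m : number M, m ⊗ zero = zero;
  mul_succ : forall m n : number M, m ⊗ (n ⊕ one) = (m ⊗ n) ⊕ m;
  lt_0 : forall m : number M, ~ m ≺ zero;
  lt_succ : forall m n : number M, m ≺ n ⊕ one <-> m ≺ n \/ m = n
}.

(** In the three schemes, [e] and [s] supply arbitrary number and set
    parameters, and the distinguished variable has index 0. *)
Definition Sigma01_induction (M : L2structure) : Prop :=
  forall p, Sigma01 p ->
  forall (s : nat -> numset M) (e : nat -> number M),
    sat M s (scons zero e) p ->
    (forall n, sat M s (scons n e) p -> sat M s (scons (n ⊕ one) e) p) ->
    forall n, sat M s (scons n e) p.

Definition Delta01_comprehension (M : L2structure) : Prop :=
  forall p q, Sigma01 p -> Pi01 q ->
  forall (s : nat -> numset M) (e : nat -> number M),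
    (forall n, sat M s (scons n e) p <-> sat M s (scons n e) q) ->
    exists X : numset M, forall n, n ∈ X <-> sat M s (scons n e) p.

Definition arithmetical_comprehension (M : L2structure) : Prop :=
  forall p (s : nat -> numset M) (e : nat -> number M),
    exists X : numset M, forall n, n ∈ X <-> sat M s (scons n e) p.

Record RCA0 (M : L2structure) : Prop := {
  RCA0_basic : basic_axioms M;
  RCA0_induction : Sigma01_induction M;
  RCA0_comprehension : Delta01_comprehension M
}.

(** * Coding inside a structure

    From here on, "set", "sequence" and "function" mean elements of
    [numset M]: all object quantifiers range over [number M] and [numset M].
    Rocq predicates on numbers ([class M]) are never quantified over; they only
    abbreviate formulas. *)

Definition class (M : L2structure) : Type := number M -> Prop.

Definition everything {M : L2structure} : class M := fun _ => True.

Definition members {M : L2structure} (X : numset M) : class M := fun x => x ∈ X.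

(** The pairing function (i,j) = (i+j)^2 + i, which is injective in RCA_0. *)
Definition pair {M : L2structure} (i j : number M) : number M :=
  ((i ⊕ j) ⊗ (i ⊕ j)) ⊕ i.

Definition triple {M : L2structure} (i j k : number M) : number M :=
  pair (pair i j) k.

Definition product {M : L2structure} (A B : class M) : class M :=
  fun p => exists x y, A x /\ B y /\ p = pair x y.

Definition maps {M : L2structure} (F : numset M) (x y : number M) : Prop :=
  pair x y ∈ F.

Definition partial_function {M : L2structure} (A B : class M) (F : numset M) : Prop :=
  (forall p, p ∈ F -> product A B p) /\
  (forall x y z, maps F x y -> maps F x z -> y = z).

Definition function {M : L2structure} (A B : class M) (F : numset M) : Prop :=
  partial_function A B F /\ (forall x, A x -> exists y, maps F x y).

(** * CSC spaces *)

Record CSC_data (M : L2structure) := {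
  points : numset M;
  basis : numset M;
  kfun : numset M
}.

(** The sequence (U_i) is coded by the set of all pairs (x,i) with x ∈ U_i. *)
Definition U {M : L2structure} (C : CSC_data M) (i : number M) : class M :=
  fun x => pair x i ∈ basis C.

Record is_CSC {M : L2structure} (C : CSC_data M) : Prop := {
  CSC_sub : forall i x, U C i x -> x ∈ points C;
  CSC_cover : forall x, x ∈ points C -> exists i, U C i x;
  CSC_kfun : partial_function
    (product (product (members (points C)) everything) everything) everything
    (kfun C);
  CSC_inter : forall x i j, U C i x -> U C j x ->
    exists m, maps (kfun C) (triple x i j) m /\ U C m x /\
      (forall z, U C m z -> U C i z /\ U C j z)
}.

Definition open_class {M : L2structure} (B : number M -> class M) (A : class M) : Prop :=
  forall x, A x -> exists i, B i x /\ (forall z, B i z -> A z).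

Definition open_set {M : L2structure} (C : CSC_data M) (A : numset M) : Prop :=
  (forall x, x ∈ A -> x ∈ points C) /\ open_class (U C) (members A).

Definition subspace_basis {M : L2structure} (C : CSC_data M) (Y : numset M)
    (i : number M) : class M :=
  fun x => U C i x /\ x ∈ Y.

Definition isolated_in {M : L2structure} (C : CSC_data M) (Y : numset M)
    (y : number M) : Prop :=
  y ∈ Y /\ open_class (subspace_basis C Y) (fun z => z = y).

Definition scattered {M : L2structure} (C : CSC_data M) : Prop :=
  forall Y : numset M, (forall x, x ∈ Y -> x ∈ points C) -> (exists x, x ∈ Y) ->
    exists y, isolated_in C Y y.

Definition T0 {M : L2structure} (C : CSC_data M) : Prop :=
  forall x y, x ∈ points C -> y ∈ points C -> x <> y ->
    exists A : numset M, open_set C A /\ ((x ∈ A /\ y ∉ A) \/ (x ∉ A /\ y ∈ A)).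

Definition regular {M : L2structure} (C : CSC_data M) : Prop :=
  forall x i, U C i x ->
    exists V W : numset M, open_set C V /\ open_set C W /\ x ∈ V /\
      (forall z, z ∈ V -> z ∈ points C /\ z ∉ W) /\
      (forall z, z ∈ points C -> z ∉ W -> U C i z).

Definition T3 {M : L2structure} (C : CSC_data M) : Prop := T0 C /\ regular C.

Definition eT2 {M : L2structure} (C : CSC_data M) : Prop :=
  exists H0 H1 : numset M,
    function (product (members (points C)) (members (points C))) everything H0 /\
    function (product (members (points C)) (members (points C))) everything H1 /\
    forall x y, x ∈ points C -> y ∈ points C -> x <> y ->
    forall i j, maps H0 (pair x y) i -> maps H1 (pair x y) j ->
      U C i x /\ U C j y /\ ~ (exists z, U C i z /\ U C j z).

Definition effectively_continuous {M : L2structure} (C D : CSC_data M)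
    (f : numset M) : Prop :=
  exists v : numset M,
    function (product (members (points C)) everything) everything v /\
    forall x y j, maps f x y -> U D j y ->
    forall i, maps v (pair x j) i ->
      U C i x /\ (forall z w, U C i z -> maps f z w -> U D j w).

Definition effective_embedding {M : L2structure} (C D : CSC_data M)
    (f : numset M) : Prop :=
  function (members (points C)) (members (points D)) f /\
  effectively_continuous C D f /\
  exists v : numset M,
    function (product (members (points C)) everything) everything v /\
    forall x i, U C i x ->
    forall j, maps v (pair x i) j ->
      (exists y, maps f x y /\ U D j y) /\
      (forall z w, maps f z w -> U D j w -> U C i z).

(** * Linear orders and the order topology *)

Record linear_order {M : L2structure} (L R : numset M) : Prop := {
  lo_sub : forall p, p ∈ R -> product (members L) (members L) p;
  lo_irrefl : forall x, pair x x ∉ R;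
  lo_trans : forall x y z, pair x y ∈ R -> pair y z ∈ R -> pair x z ∈ R;
  lo_total : forall x y, x ∈ L -> y ∈ L -> pair x y ∈ R \/ x = y \/ pair y x ∈ R
}.

(** Elements of L ∪ {-∞,+∞} are coded by numbers: -∞ by 0, +∞ by 1, and
    a ∈ L by a+2. *)
Definition minus_infty {M : L2structure} : number M := zero.
Definition plus_infty {M : L2structure} : number M := one.
Definition fin {M : L2structure} (a : number M) : number M := (a ⊕ one) ⊕ one.

Definition endpoint {M : L2structure} (L : numset M) : class M :=
  fun e => e = minus_infty \/ e = plus_infty \/ exists a, a ∈ L /\ e = fin a.

Definition ext_lt {M : L2structure} (L R : numset M) (d e : number M) : Prop :=
  (d = minus_infty /\ e = plus_infty) \/
  (d = minus_infty /\ exists b, b ∈ L /\ e = fin b) \/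
  ((exists a, a ∈ L /\ d = fin a) /\ e = plus_infty) \/
  (exists a b, pair a b ∈ R /\ d = fin a /\ e = fin b).

Definition ext_le {M : L2structure} (L R : numset M) (d e : number M) : Prop :=
  d = e \/ ext_lt L R d e.

Definition is_max {M : L2structure} (L R : numset M) (a b m : number M) : Prop :=
  (ext_le L R a b /\ m = b) \/ (ext_le L R b a /\ m = a).

Definition is_min {M : L2structure} (L R : numset M) (a b m : number M) : Prop :=
  (ext_le L R a b /\ m = a) \/ (ext_le L R b a /\ m = b).

Definition interval {M : L2structure} (L R : numset M) (a b : number M) : class M :=
  fun x => x ∈ L /\ ext_lt L R a (fin x) /\ ext_lt L R (fin x) b.

(** The index of ]a,b[ is the pair (a,b); numbers that do not code a pair of
    endpoints index the empty set. *)
Record order_topology {M : L2structure} (L R : numset M) (D : CSC_data M) : Prop := {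
  ot_points : forall x, x ∈ points D <-> x ∈ L;
  ot_basis : forall p, p ∈ basis D <->
    exists z a b, endpoint L a /\ endpoint L b /\ interval L R a b z /\
      p = pair z (pair a b);
  ot_kfun : forall p, p ∈ kfun D <->
    exists z a b x y c d,
      z ∈ L /\ endpoint L a /\ endpoint L b /\ endpoint L x /\ endpoint L y /\
      is_max L R a x c /\ is_min L R b y d /\
      p = pair (triple z (pair a b) (pair x y)) (pair c d)
}.

Definition effectively_embeds_in_linear_order {M : L2structure} (C : CSC_data M) : Prop :=
  exists (L R : numset M) (D : CSC_data M) (f : numset M),
    linear_order L R /\ order_topology L R D /\ effective_embedding C D f.

(* Main.v *)
(** It suffices to form [{n | exists s, (s,n) ∈ A}] where each [n] has at most one
    witness [s]. Consider a space with points [x_n], isolated points [z_{n,m,i}] and,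
    for each [(s,n) ∈ A], points [y_{n,s,i}]. The [j]-th neighbourhood of [x_n] is
    [{x_n} ∪ {z_{n,m,i} : m >= j}], shrunk to [{x_n}] when the witness of [n] is below
    [j]; the [j]-th neighbourhood of [y_{n,s,i}] is [{y_{n,s,i}} ∪ {z_{n,m,i} : m >= j}].
    Given an effective embedding into a linear order, choose an interval [I] around
    the image of [x_n] whose preimage lies in the 0-th neighbourhood of [x_n], and [j]
    such that the [j]-th neighbourhood is mapped into [I]. If the witness [s] of [n]
    were at least [j], then every [z_{n,m,i}] with [m >= j] would be mapped into [I], so
    each [y_{n,s,i}] would be mapped into the closure of [I] but outside [I], that is, to
    an end point of [I]; but [y_{n,s,0}], [y_{n,s,1}], [y_{n,s,2}] have three distinct
    images. So [j] bounds the witness, and the set is Delta^0_1. *)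

Require Import Defs.
From Stdlib Require Import List PeanoNat Lia Classical FunctionalExtensionality Ring.

(** * Bounded-quantifier definability of predicates on environments *)

Section Definability.
Context {M : L2structure}.

Definition definable_term (t : (nat -> number M) -> number M) : Prop :=
  exists u, forall e, teval M e u = t e.

(** Speaking of predicates rather than formulas allows the axiom schemes to be applied to readable
    propositions instead of syntax trees. *)
Definition Delta00 (s : nat -> numset M) (P : (nat -> number M) -> Prop) : Prop :=
  exists p, Sigma00 p /\ forall e, sat M s e p <-> P e.

Lemma term_var (k : nat) : definable_term (fun e => e k).
Proof. now exists (TVar k). Qed.

Lemma term_zero : definable_term (fun _ => zero).
Proof. now exists TZero. Qed.

Lemma term_one : definable_term (fun _ => one).
Proof. now exists TOne. Qed.

Lemma term_add t u :
  definable_term t -> definable_term u -> definable_term (fun e => t e ⊕ u e).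
Proof.
  intros [t' Ht] [u' Hu]; exists (TAdd t' u'); intro e; simpl.
  now rewrite Ht, Hu.
Qed.

Lemma term_mul t u :
  definable_term t -> definable_term u -> definable_term (fun e => t e ⊗ u e).
Proof.
  intros [t' Ht] [u' Hu]; exists (TMul t' u'); intro e; simpl.
  now rewrite Ht, Hu.
Qed.

Lemma term_pair t u :
  definable_term t -> definable_term u -> definable_term (fun e => pair (t e) (u e)).
Proof. intros; unfold pair; auto using term_add, term_mul. Qed.

Lemma term_triple t u v :
  definable_term t -> definable_term u -> definable_term v ->
  definable_term (fun e => triple (t e) (u e) (v e)).
Proof. intros; unfold triple; auto using term_pair. Qed.

Lemma teval_lift x e t : teval M (scons x e) (lift t) = teval M e t.
Proof. induction t; simpl; congruence. Qed.

Context (s : nat -> numset M).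

Lemma Delta00_eq t u :
  definable_term t -> definable_term u -> Delta00 s (fun e => t e = u e).
Proof.
  intros [t' Ht] [u' Hu]; exists (FEq t' u'); split; [constructor|].
  intro e; simpl; rewrite Ht, Hu; tauto.
Qed.

Lemma Delta00_lt t u :
  definable_term t -> definable_term u -> Delta00 s (fun e => t e ≺ u e).
Proof.
  intros [t' Ht] [u' Hu]; exists (FLt t' u'); split; [constructor|].
  intro e; simpl; rewrite Ht, Hu; tauto.
Qed.

Lemma Delta00_in X t :
  (exists k, s k = X) -> definable_term t -> Delta00 s (fun e => t e ∈ X).
Proof.
  intros [k <-] [t' Ht]; exists (FIn t' k); split; [constructor|].
  intro e; simpl; rewrite Ht; tauto.
Qed.

Lemma Delta00_not P : Delta00 s P -> Delta00 s (fun e => ~ P e).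
Proof.
  intros [p [Hp Ep]]; exists (FNot p); split; [now constructor|].
  intro e; simpl; rewrite Ep; tauto.
Qed.

Lemma Delta00_and P Q :
  Delta00 s P -> Delta00 s Q -> Delta00 s (fun e => P e /\ Q e).
Proof.
  intros [p [Hp Ep]] [q [Hq Eq]]; exists (FAnd p q); split; [now constructor|].
  intro e; simpl; rewrite Ep, Eq; tauto.
Qed.

Lemma Delta00_or P Q :
  Delta00 s P -> Delta00 s Q -> Delta00 s (fun e => P e \/ Q e).
Proof.
  intros [p [Hp Ep]] [q [Hq Eq]]; exists (FOr p q); split; [now constructor|].
  intro e; simpl; rewrite Ep, Eq; tauto.
Qed.

Lemma Delta00_imp P Q :
  Delta00 s P -> Delta00 s Q -> Delta00 s (fun e => P e -> Q e).
Proof.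
  intros [p [Hp Ep]] [q [Hq Eq]]; exists (FImp p q); split; [now constructor|].
  intro e; simpl; rewrite Ep, Eq; tauto.
Qed.

(** In the next two lemmas the bound variable is read off as the 0-th entry of
    the environment, so that [Q] is found by higher-order pattern unification. *)
Lemma Delta00_ex t Q :
  definable_term t -> Delta00 s (fun e => Q (e 0) (fun n => e (S n))) ->
  Delta00 s (fun e => exists x, x ≺ t e /\ Q x e).
Proof.
  intros [t' Ht] [q [Hq Eq]].
  exists (FEx (FAnd (FLt (TVar 0) (lift t')) q)); split; [now constructor|].
  intro e; simpl.
  split; intros [x Hx]; exists x; rewrite teval_lift, Ht, Eq in *; exact Hx.
Qed.

Lemma Delta00_all t Q :
  definable_term t -> Delta00 s (fun e => Q (e 0) (fun n => e (S n))) ->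
  Delta00 s (fun e => forall x, x ≺ t e -> Q x e).
Proof.
  intros [t' Ht] [q [Hq Eq]].
  exists (FAll (FImp (FLt (TVar 0) (lift t')) q)); split; [now constructor|].
  intro e; simpl.
  split; intros H x; specialize (H x); rewrite teval_lift, Ht, Eq in *; exact H.
Qed.

Lemma Delta00_ext P Q :
  (forall e, P e <-> Q e) -> Delta00 s P -> Delta00 s Q.
Proof.
  intros H [p [Hp Ep]]; exists p; split; [exact Hp|].
  intro e; now rewrite Ep.
Qed.

End Definability.

(** * Automation for definability *)

Ltac definable_term :=
  lazymatch goal with
  | |- definable_term (fun _ => zero) => apply term_zero
  | |- definable_term (fun _ => one) => apply term_one
  | |- definable_term (fun e => pair _ _) => apply term_pair; definable_term
  | |- definable_term (fun e => triple _ _ _) => apply term_triple; definable_term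
  | |- definable_term (fun e => _ ⊕ _) => apply term_add; definable_term
  | |- definable_term (fun e => _ ⊗ _) => apply term_mul; definable_term
  | |- _ => solve [apply term_var | auto]
  end.

Ltac delta00 :=
  lazymatch goal with
  | |- Delta00 _ (fun e => exists x, x ≺ _ /\ _) =>
      apply Delta00_ex; [definable_term | cbv beta; delta00]
  | |- Delta00 _ (fun e => forall x, x ≺ _ -> _) =>
      apply Delta00_all; [definable_term | cbv beta; delta00]
  | |- Delta00 _ (fun e => ~ _) => apply Delta00_not; delta00
  | |- Delta00 _ (fun e => _ /\ _) => apply Delta00_and; delta00
  | |- Delta00 _ (fun e => _ \/ _) => apply Delta00_or; delta00
  | |- Delta00 _ (fun e => _ = _) => apply Delta00_eq; definable_term
  | |- Delta00 _ (fun e => _ ≺ _) => apply Delta00_lt; definable_term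
  | |- Delta00 _ (fun e => _ ∈ _) =>
      apply Delta00_in;
      [first [assumption | now exists 0 | now exists 1 | now exists 2 | now exists 3] | definable_term]
  | |- Delta00 _ (fun e => _ -> _) => apply Delta00_imp; delta00
  | |- _ => idtac
  end.

(** * Ordered semiring laws and pairing in RCA_0 *)

Section Arithmetic.
Context {M : L2structure} (HM : RCA0 M).

(** In the definability hypothesis, variable 0 is the existential witness, variable 1 the induction
    variable, and the parameters start at 2. *)
Lemma Sigma01_ind s e (P : number M -> number M -> (nat -> number M) -> Prop) :
  Delta00 s (fun e => P (e 0) (e 1) (fun k => e (S (S k)))) ->
  (exists x, P x zero e) ->
  (forall n, (exists x, P x n e) -> exists x, P x (n ⊕ one) e) ->
  forall n, exists x, P x n e.
Proof.
  intros [p [Hp Ep]] H0 HS n.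
  assert (E : forall n, sat M s (scons n e) (FEx p) <-> exists x, P x n e).
  { intro m; simpl; split; intros [x Hx]; exists x;
      apply (Ep (scons x (scons m e))), Hx. }
  apply E; apply (RCA0_induction HM); [now constructor|now apply E|].
  intros m Hm; apply E, HS, E, Hm.
Qed.

(** A dummy existential quantifier makes the predicate Sigma01, which is why variable 0 is
    skipped. *)
Lemma Delta00_ind s e (P : number M -> (nat -> number M) -> Prop) :
  Delta00 s (fun e => P (e 1) (fun k => e (S (S k)))) ->
  P zero e -> (forall n, P n e -> P (n ⊕ one) e) -> forall n, P n e.
Proof.
  intros HP H0 HS n.
  destruct (Sigma01_ind s e (fun _ => P) HP (ex_intro _ zero H0)
              (fun m Hm => let (x, H) := Hm in ex_intro _ x (HS m H)) n) as [_ H].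
  exact H.
Qed.


(* A structure without sets satisfies the induction scheme vacuously, hence [X0]. *)
Context (X0 : numset M).

Lemma Delta00_ind_num (P : number M -> (nat -> number M) -> Prop) (a b : number M) :
  Delta00 (fun _ => X0) (fun e => P (e 1) (fun k => e (S (S k)))) ->
  P zero (scons a (fun _ => b)) ->
  (forall n, P n (scons a (fun _ => b)) -> P (n ⊕ one) (scons a (fun _ => b))) ->
  forall n, P n (scons a (fun _ => b)).
Proof. apply Delta00_ind. Qed.

Lemma add_0_l (n : number M) : zero ⊕ n = n.
Proof.
  pose proof (RCA0_basic HM) as B.
  apply (Delta00_ind_num (fun n _ => zero ⊕ n = n) zero zero).
  - delta00.
  - apply (add_0 B).
  - intros m H; rewrite (add_succ B); congruence.
Qed.

Lemma add_succ_l (m n : number M) : (m ⊕ one) ⊕ n = (m ⊕ n) ⊕ one.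
Proof.
  pose proof (RCA0_basic HM) as B.
  apply (Delta00_ind_num (fun n e => (e 0 ⊕ one) ⊕ n = (e 0 ⊕ n) ⊕ one) m zero);
    simpl.
  - delta00.
  - now rewrite !(add_0 B).
  - intros k H; rewrite !(add_succ B); congruence.
Qed.

Lemma add_comm (m n : number M) : m ⊕ n = n ⊕ m.
Proof.
  pose proof (RCA0_basic HM) as B.
  apply (Delta00_ind_num (fun n e => e 0 ⊕ n = n ⊕ e 0) m zero); simpl.
  - delta00.
  - now rewrite (add_0 B), add_0_l.
  - intros k H; rewrite (add_succ B), add_succ_l; congruence.
Qed.

Lemma add_assoc (m n k : number M) : m ⊕ (n ⊕ k) = (m ⊕ n) ⊕ k.
Proof.
  pose proof (RCA0_basic HM) as B.
  apply (Delta00_ind_num (fun k e => e 0 ⊕ (e 1 ⊕ k) = (e 0 ⊕ e 1) ⊕ k) m n); simpl.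
  - delta00.
  - now rewrite !(add_0 B).
  - intros l H; rewrite !(add_succ B); congruence.
Qed.

Lemma mul_0_l (n : number M) : zero ⊗ n = zero.
Proof.
  pose proof (RCA0_basic HM) as B.
  apply (Delta00_ind_num (fun n _ => zero ⊗ n = zero) zero zero); simpl.
  - delta00.
  - apply (mul_0 B).
  - intros k H; now rewrite (mul_succ B), (add_0 B).
Qed.

Lemma mul_succ_l (m n : number M) : (m ⊕ one) ⊗ n = (m ⊗ n) ⊕ n.
Proof.
  pose proof (RCA0_basic HM) as B.
  apply (Delta00_ind_num (fun n e => (e 0 ⊕ one) ⊗ n = (e 0 ⊗ n) ⊕ n) m zero); simpl.
  - delta00.
  - now rewrite !(mul_0 B), (add_0 B).
  - intros k H; rewrite !(mul_succ B), !(add_succ B), H.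
    now rewrite <- (add_assoc _ k m), (add_comm k m), add_assoc.
Qed.

Lemma mul_comm (m n : number M) : m ⊗ n = n ⊗ m.
Proof.
  pose proof (RCA0_basic HM) as B.
  apply (Delta00_ind_num (fun n e => e 0 ⊗ n = n ⊗ e 0) m zero); simpl.
  - delta00.
  - now rewrite (mul_0 B), mul_0_l.
  - intros k H; rewrite (mul_succ B), mul_succ_l; congruence.
Qed.

Lemma mul_add_distr_r (m n k : number M) : (m ⊕ n) ⊗ k = (m ⊗ k) ⊕ (n ⊗ k).
Proof.
  pose proof (RCA0_basic HM) as B.
  apply (Delta00_ind_num
           (fun k e => (e 0 ⊕ e 1) ⊗ k = (e 0 ⊗ k) ⊕ (e 1 ⊗ k)) m n); simpl.
  - delta00.
  - now rewrite !(mul_0 B), (add_0 B).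
  - intros l H; rewrite !(mul_succ B), H.
    rewrite <- !add_assoc; f_equal.
    now rewrite !add_assoc, (add_comm m (n ⊗ l)).
Qed.

Lemma mul_assoc (m n k : number M) : m ⊗ (n ⊗ k) = (m ⊗ n) ⊗ k.
Proof.
  pose proof (RCA0_basic HM) as B.
  apply (Delta00_ind_num (fun k e => e 0 ⊗ (e 1 ⊗ k) = (e 0 ⊗ e 1) ⊗ k) m n); simpl.
  - delta00.
  - now rewrite !(mul_0 B).
  - intros l H; rewrite !(mul_succ B).
    rewrite (mul_comm m (n ⊗ l ⊕ n)), mul_add_distr_r.
    rewrite (mul_comm (n ⊗ l)), (mul_comm n m); congruence.
Qed.

(** Makes [ring] available in the model; order facts then reduce to polynomial identities with
    explicit differences. *)
Lemma number_semi_ring :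
  semi_ring_theory (zero : number M) one add mul eq.
Proof.
  pose proof (RCA0_basic HM) as B.
  constructor; auto using add_0_l, add_comm, add_assoc, mul_0_l, mul_comm,
    mul_assoc, mul_add_distr_r.
  intro n; rewrite mul_comm.
  now rewrite <- (add_0_l one), (mul_succ B), (mul_0 B), add_0_l.
Qed.

Add Ring number_ring : number_semi_ring.

Lemma add_cancel_r (m n k : number M) : m ⊕ k = n ⊕ k -> m = n.
Proof.
  pose proof (RCA0_basic HM) as B.
  apply (Delta00_ind_num (fun k e => e 0 ⊕ k = e 1 ⊕ k -> e 0 = e 1) m n); simpl.
  - delta00.
  - now rewrite !(add_0 B).
  - intros l H; rewrite !(add_succ B); intro E; apply H, (succ_inj B), E.
Qed.

Lemma zero_or_succ (n : number M) : n = zero \/ exists m, n = m ⊕ one.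
Proof.
  pose proof (RCA0_basic HM) as B.
  assert (H : n = zero \/ exists m, m ≺ n /\ n = m ⊕ one).
  { apply (Delta00_ind_num
             (fun n _ => n = zero \/ exists m, m ≺ n /\ n = m ⊕ one) zero zero).
    - delta00.
    - now left.
    - intros k _; right; exists k; split; auto; apply (lt_succ B); auto. }
  destruct H as [H|[m [_ H]]]; eauto.
Qed.

Lemma lt_add_succ (m d : number M) : m ≺ m ⊕ (d ⊕ one).
Proof.
  pose proof (RCA0_basic HM) as B.
  apply (Delta00_ind_num (fun d e => e 0 ≺ e 0 ⊕ (d ⊕ one)) m zero); simpl.
  - delta00.
  - rewrite add_0_l; apply (lt_succ B); auto.
  - intros k H; rewrite (add_succ B); apply (lt_succ B); auto.
Qed.

Lemma lt_exists (m n : number M) : m ≺ n <-> exists d, n = m ⊕ (d ⊕ one).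
Proof.
  pose proof (RCA0_basic HM) as B.
  split; [|intros [d ->]; apply lt_add_succ].
  (* With the quantifier in front of the implication the statement is Sigma01, so induction
     applies. *)
  assert (H : exists d, m ≺ n -> n = m ⊕ (d ⊕ one)).
  { apply (Sigma01_ind (fun _ => X0) (fun _ => m)
             (fun d n e => e 0 ≺ n -> n = e 0 ⊕ (d ⊕ one))).
    - delta00.
    - exists zero; intro H; now apply (lt_0 B) in H.
    - intros k [d H].
      destruct (classic (m ≺ k)) as [L|L].
      + exists (d ⊕ one); intros _; rewrite (H L) at 1; ring.
      + exists zero; intro L'; apply (lt_succ B) in L' as [L'| ->]; [easy|ring]. }
  destruct H as [d H]; eauto.
Qed.

Lemma lt_irrefl (n : number M) : ~ n ≺ n.
Proof.
  pose proof (RCA0_basic HM) as B.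
  intro H; apply lt_exists in H as [d H].
  apply (succ_neq0 B d), add_cancel_r with n; rewrite add_0_l, add_comm; auto.
Qed.

Lemma lt_trans (m n k : number M) : m ≺ n -> n ≺ k -> m ≺ k.
Proof.
  intros H1 H2; apply lt_exists in H1 as [d ->]; apply lt_exists in H2 as [d' ->].
  apply lt_exists; exists (d ⊕ d' ⊕ one); ring.
Qed.

Lemma lt_total (m n : number M) : m ≺ n \/ m = n \/ n ≺ m.
Proof.
  pose proof (RCA0_basic HM) as B.
  apply (Delta00_ind_num (fun m e => m ≺ e 0 \/ m = e 0 \/ e 0 ≺ m) n zero); simpl.
  - delta00.
  - destruct (zero_or_succ n) as [-> |[m' ->]]; auto.
    left; apply lt_exists; exists m'; ring.
  - intros k [H|[-> |H]].
    + apply lt_exists in H as [d ->].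
      destruct (zero_or_succ d) as [-> |[d' ->]].
      * right; left; ring.
      * left; apply lt_exists; exists d'; ring.
    + right; right; apply (lt_succ B); auto.
    + right; right; apply (lt_succ B); auto.
Qed.

(** Here and below, [m ≺ n ⊕ one] plays the part of the non-strict order. *)
Lemma lt_succ_exists (m n : number M) : m ≺ n ⊕ one <-> exists d, n = m ⊕ d.
Proof.
  pose proof (RCA0_basic HM) as B.
  rewrite lt_exists; split; intros [d H]; exists d.
  - apply (succ_inj B); rewrite H; ring.
  - rewrite H; ring.
Qed.

Lemma le_refl (n : number M) : n ≺ n ⊕ one.
Proof. apply (lt_succ (RCA0_basic HM)); auto. Qed.

Lemma le_add_l (m n : number M) : m ≺ m ⊕ n ⊕ one.
Proof. apply lt_succ_exists; eauto. Qed.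

Lemma le_add_r (m n : number M) : n ≺ m ⊕ n ⊕ one.
Proof. apply lt_succ_exists; exists m; ring. Qed.

Lemma lt_le_trans (m n k : number M) : m ≺ n -> n ≺ k ⊕ one -> m ≺ k.
Proof.
  rewrite lt_succ_exists, !lt_exists; intros [d ->] [d' ->].
  exists (d ⊕ d'); ring.
Qed.

Lemma le_trans (m n k : number M) : m ≺ n ⊕ one -> n ≺ k ⊕ one -> m ≺ k ⊕ one.
Proof.
  rewrite !lt_succ_exists; intros [d ->] [d' ->]; exists (d ⊕ d'); ring.
Qed.

Lemma not_lt (m n : number M) : ~ m ≺ n <-> n ≺ m ⊕ one.
Proof.
  pose proof (RCA0_basic HM) as B.
  rewrite (lt_succ B); split.
  - destruct (lt_total m n) as [H|[H|H]]; auto; tauto.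
  - intros [H| ->] L; [exact (lt_irrefl _ (lt_trans _ _ _ H L)) | exact (lt_irrefl _ L)].
Qed.

(** Raising the sum by at least one raises its square by more than twice the old sum, which
    outweighs the summand [a]. *)
Lemma lt_pair (a b c d : number M) : a ⊕ b ≺ c ⊕ d -> pair a b ≺ pair c d.
Proof.
  intro H; apply lt_exists in H as [k H]; apply lt_exists.
  (* The difference of the two codes, less one, expanded so that no subtraction is left. *)
  exists (a ⊕ b ⊕ b ⊕ k ⊕ k ⊕ k ⊗ k ⊕ (a ⊕ b) ⊗ k ⊕ (a ⊕ b) ⊗ k ⊕ c).
  unfold pair; rewrite H; ring.
Qed.

(** Unequal sums give unequal codes by [lt_pair]; for equal sums the squares cancel. *)
Lemma pair_inj (a b c d : number M) : pair a b = pair c d -> a = c /\ b = d.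
Proof.
  intro E.
  destruct (lt_total (a ⊕ b) (c ⊕ d)) as [H|[H|H]].
  - apply lt_pair in H; rewrite E in H; now apply lt_irrefl in H.
  - unfold pair in E; rewrite H in E.
    assert (a = c).
    { apply add_cancel_r with ((c ⊕ d) ⊗ (c ⊕ d)).
      now rewrite (add_comm a), (add_comm c ((c ⊕ d) ⊗ _)). }
    subst; split; auto; apply add_cancel_r with c.
    now rewrite (add_comm b), (add_comm d).
  - apply lt_pair in H; rewrite E in H; now apply lt_irrefl in H.
Qed.

Lemma le_square (n : number M) : exists d, n ⊗ n = n ⊕ d.
Proof.
  destruct (zero_or_succ n) as [-> |[m ->]].
  - exists zero; ring.
  - exists (m ⊗ m ⊕ m); ring.
Qed.

(** Components never exceed their code, so quantifiers over them can be bounded by the code. *)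
Lemma le_pair_l (a b : number M) : a ≺ pair a b ⊕ one.
Proof. apply lt_succ_exists; unfold pair; eexists; apply add_comm. Qed.

Lemma le_pair_r (a b : number M) : b ≺ pair a b ⊕ one.
Proof.
  apply lt_succ_exists; unfold pair; destruct (le_square (a ⊕ b)) as [d ->].
  exists (a ⊕ d ⊕ a); ring.
Qed.

(** * Comprehension in terms of predicates *)

Lemma Delta01_comp s e (P Q : number M -> number M -> (nat -> number M) -> Prop) :
  Delta00 s (fun e => P (e 0) (e 1) (fun k => e (S (S k)))) ->
  Delta00 s (fun e => Q (e 0) (e 1) (fun k => e (S (S k)))) ->
  (forall n, (exists x, P x n e) <-> (forall x, Q x n e)) ->
  exists X, forall n, n ∈ X <-> exists x, P x n e.
Proof.
  intros [p [Hp Ep]] [q [Hq Eq]] H.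
  assert (E : forall n, sat M s (scons n e) (FEx p) <-> exists x, P x n e).
  { intro m; simpl; split; intros [x Hx]; exists x;
      apply (Ep (scons x (scons m e))), Hx. }
  assert (E' : forall n, sat M s (scons n e) (FAll q) <-> forall x, Q x n e).
  { intro m; simpl; split; intros Hx x; apply (Eq (scons x (scons m e))), Hx. }
  destruct (RCA0_comprehension HM (p := FEx p) (q := FAll q)) with (s := s) (e := e) as [X HX].
  - now constructor.
  - now constructor.
  - intro n; rewrite E, E'; apply H.
  - exists X; intro n; now rewrite HX, E.
Qed.

Lemma Delta00_comp s e (P : number M -> (nat -> number M) -> Prop) :
  Delta00 s (fun e => P (e 1) (fun k => e (S (S k)))) ->
  exists X, forall n, n ∈ X <-> P n e.
Proof.
  intro H; destruct (Delta01_comp s e (fun _ => P) (fun _ => P) H H) as [X HX].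
  - intro n; split; [now intros [_ Hn]|intro Hn; exists zero; auto].
  - exists X; intro n; rewrite HX; split; [now intros [_ Hn]|].
    intro Hn; exists zero; auto.
Qed.

Lemma Delta00_comp0 s (P : number M -> Prop) :
  Delta00 s (fun e => P (e 1)) -> exists X, forall n, n ∈ X <-> P n.
Proof. apply (Delta00_comp s (fun _ => zero) (fun n _ => P n)). Qed.

(** Definability is required at arbitrary variable positions because [P] ends up below two bounded
    quantifiers over the components of a code. *)
Lemma binary_comp s (P : number M -> number M -> Prop) :
  (forall i j, Delta00 s (fun e => P (e i) (e j))) ->
  exists X, (forall x y, pair x y ∈ X <-> P x y) /\
    (forall c, c ∈ X -> exists x y, c = pair x y).
Proof.
  intro H.
  destruct (Delta00_comp0 s (fun c => exists x, x ≺ c ⊕ one /\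
              exists y, y ≺ c ⊕ one /\ (c = pair x y /\ P x y))) as [X HX].
  { delta00; apply H. }
  exists X; split.
  - intros x y; rewrite HX; split.
    + intros (x' & _ & y' & _ & E & HP).
      now apply pair_inj in E as [-> ->].
    + intro HP; exists x; split; [apply le_pair_l|].
      exists y; split; [apply le_pair_r|auto].
  - intros c Hc; apply HX in Hc as (x & _ & y & _ & E & _); eauto.
Qed.

Lemma everything_comp : exists X : numset M, forall n, n ∈ X.
Proof.
  destruct (Delta00_comp0 (fun _ => X0) (fun n => n = n)) as [X HX].
  - delta00.
  - exists X; intro n; now apply HX.
Qed.

(** * Arithmetical comprehension from projections *)

Definition extend (l : list (number M)) (e : nat -> number M) : nat -> number M :=
  fold_right (@scons _) e l.

(** The length cannot be recovered, since [pair zero zero] equals [zero]; codes are therefore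
    compared only at a fixed length. *)
Definition code (l : list (number M)) : number M := fold_right pair zero l.

Lemma extend_nth l e n :
  extend l e n = if (n <? length l)%nat then nth n l zero else e (n - length l).
Proof.
  revert n; induction l as [|a l IH]; intro n; simpl.
  - now rewrite Nat.sub_0_r.
  - destruct n as [|n]; simpl; [easy|apply IH].
Qed.

(** For a fixed metatheoretic length [k], quantifying over lists unfolds to nested bounded
    quantifiers. The renaming [r] tracks where the variables of [Q] sit as these quantifiers are
    opened. *)
Lemma tuples_definable s k : forall (Q : (nat -> number M) -> Prop) i r,
  (forall r, Delta00 s (fun e => Q (fun n => e (r n)))) ->
  Delta00 s (fun e => exists l, length l = k /\ e i = code l /\
                      Q (extend l (fun n => e (r n)))).
Proof.
  induction k as [|k IH]; intros Q i r HQ.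
  - apply Delta00_ext with (fun e => e i = zero /\ Q (fun n => e (r n))).
    + intro e; split.
      * intros [E H]; now exists nil.
      * intros ([|a l] & Hl & E & H); [auto|discriminate].
    + delta00; apply HQ.
  - apply Delta00_ext with (fun e =>
      exists a, a ≺ e i ⊕ one /\ exists c, c ≺ e i ⊕ one /\ (e i = pair a c /\
        exists l, length l = k /\ c = code l /\
          Q (scons a (extend l (fun n => e (r n)))))).
    + intro e; split.
      * intros (a & _ & c & _ & E & l & Hl & -> & H).
        exists (a :: l); simpl; auto.
      * intros ([|a l] & Hl & E & H); [discriminate|].
        exists a; split; [rewrite E; apply le_pair_l|].
        exists (code l); split; [rewrite E; apply le_pair_r|].
        split; [exact E|]; exists l; auto.
    + delta00.
      (* [Q'] moves the variable for [a] behind those for [l]. *)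
      set (Q' e := Q (fun n => e (match n with
                                  | 0 => k
                                  | S m => if (m <? k)%nat then m else S m
                                  end)) : Prop).
      (* At this point [e 0] is the code [c] of the tail, [e 1] is [a], and the older variables
         start at 2. *)
      apply Delta00_ext with (fun e => exists l, length l = k /\ e 0 = code l /\
        Q' (extend l (fun n => e (match n with 0 => 1 | S m => S (S (r m)) end)))).
      * intro e; unfold Q'.
        assert (E : forall l, length l = k ->
          (fun n => extend l (fun n => e (match n with 0 => 1 | S m => S (S (r m)) end))
             (match n with 0 => k | S m => if (m <? k)%nat then m else S m end)) =
          scons (e 1) (extend l (fun n => e (S (S (r n)))))).
        { intros l Hl; apply functional_extensionality; intros [|m]; simpl.
          - now rewrite extend_nth, Hl, Nat.ltb_irrefl, Nat.sub_diag.
          - rewrite !extend_nth, Hl.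
            destruct (m <? k)%nat eqn:Em; rewrite ?Em; [easy|].
            apply Nat.ltb_ge in Em.
            destruct (Nat.ltb_spec (S m) k); [lia|].
            now replace (S m - k) with (S (m - k)) by lia. }
        split; intros (l & Hl & H); exists l; (split; [exact Hl|]);
          rewrite (E l Hl) in *; exact H.
      * apply IH; intro r'; unfold Q'.
        apply (HQ (fun n => r' (match n with 0 => k | S m => if (m <? k)%nat then m else S m end))).
Qed.

Lemma term_rename t r : definable_term (fun e : nat -> number M => teval M (fun n => e (r n)) t).
Proof.
  induction t; simpl.
  - apply term_var.
  - apply term_zero.
  - apply term_one.
  - now apply term_add.
  - now apply term_mul.
Qed.

Lemma tuples_comp s e k (Q : (nat -> number M) -> Prop) :
  (forall r, Delta00 s (fun e => Q (fun n => e (r n)))) ->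
  exists X, forall l, length l = k -> (code l ∈ X <-> Q (extend l e)).
Proof.
  intro HQ.
  destruct (Delta00_comp s e (fun c e => exists l, length l = k /\ c = code l /\
                                           Q (extend l e))) as [X HX].
  (* Position 1 holds the candidate code, position 0 being the dummy of [Delta00_comp]. *)
  { exact (tuples_definable s k Q 1 (fun n => S (S n)) HQ). }
  exists X; intros l Hl; rewrite HX; split; [|eauto].
  intros (l' & Hl' & E & H); enough (l = l') by now subst.
  clear HX H HQ; revert k l' Hl Hl' E.
  induction l as [|a l IH]; intros k [|a' l'] Hl Hl' E; simpl in *; try congruence.
  apply pair_inj in E as [-> E].
  f_equal; apply (IH (length l)); congruence.
Qed.

Lemma complement_comp (X : numset M) : exists Y : numset M, forall n, n ∈ Y <-> n ∉ X.
Proof. apply (Delta00_comp0 (fun _ => X) (fun n => n ∉ X)); delta00. Qed.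

Lemma intersection_comp (X Y : numset M) :
  exists Z : numset M, forall n, n ∈ Z <-> n ∈ X /\ n ∈ Y.
Proof.
  apply (Delta00_comp0 (scons X (fun _ => Y)) (fun n => n ∈ X /\ n ∈ Y)); delta00.
Qed.

Definition projections_exist : Prop :=
  forall A : numset M, exists Y : numset M, forall n, n ∈ Y <-> exists s, pair s n ∈ A.

(** Induction on the formula. All values of the first [k] variables are treated at once, because
    each quantifier moves one more variable into the tuple. Classical logic reduces everything to
    negation, conjunction and projection. *)
Lemma arithmetical_tuples_comp (HP : projections_exist) p : forall s e k,
  exists X, forall l, length l = k -> (code l ∈ X <-> sat M s (extend l e) p).
Proof.
  assert (Hnot : forall k (P : list (number M) -> Prop),
    (exists X, forall l, length l = k -> (code l ∈ X <-> P l)) ->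
    exists X, forall l, length l = k -> (code l ∈ X <-> ~ P l)).
  { intros k P [X HX]; destruct (complement_comp X) as [Y HY].
    exists Y; intros l Hl; now rewrite HY, HX. }
  assert (Hand : forall k (P Q : list (number M) -> Prop),
    (exists X, forall l, length l = k -> (code l ∈ X <-> P l)) ->
    (exists X, forall l, length l = k -> (code l ∈ X <-> Q l)) ->
    exists X, forall l, length l = k -> (code l ∈ X <-> P l /\ Q l)).
  { intros k P Q [X HX] [Y HY]; destruct (intersection_comp X Y) as [Z HZ].
    exists Z; intros l Hl; now rewrite HZ, HX, HY. }
  assert (Hex : forall k (P : number M -> list (number M) -> Prop),
    (exists X, forall a l, length l = k -> (pair a (code l) ∈ X <-> P a l)) ->
    exists X, forall l, length l = k -> (code l ∈ X <-> exists a, P a l)).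
  { intros k P [X HX]; destruct (HP X) as [Y HY].
    exists Y; intros l Hl; rewrite HY.
    split; intros [a Ha]; exists a; now apply HX. }
  assert (Hext : forall k (P Q : list (number M) -> Prop), (forall l, P l <-> Q l) ->
    (exists X, forall l, length l = k -> (code l ∈ X <-> P l)) ->
    exists X, forall l, length l = k -> (code l ∈ X <-> Q l)).
  { intros k P Q H [X HX]; exists X; intros l Hl; now rewrite HX, H. }
  induction p as [t u|t u|t i|p IH|p IHp q IHq|p IHp q IHq|p IHp q IHq|p IH|p IH];
    intros s e k; simpl.
  - apply (tuples_comp s e k (fun e => teval M e t = teval M e u)); intro r.
    apply Delta00_eq; apply term_rename.
  - apply (tuples_comp s e k (fun e => teval M e t ≺ teval M e u)); intro r.
    apply Delta00_lt; apply term_rename.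
  - apply (tuples_comp s e k (fun e => teval M e t ∈ s i)); intro r.
    apply Delta00_in; [now exists i|apply term_rename].
  - apply Hnot, IH.
  - apply Hand; auto.
  - apply Hext with
      (fun l => ~ (~ sat M s (extend l e) p /\ ~ sat M s (extend l e) q)).
    + intro l; tauto.
    + apply Hnot, Hand; apply Hnot; auto.
  - apply Hext with
      (fun l => ~ (sat M s (extend l e) p /\ ~ sat M s (extend l e) q)).
    + intro l; tauto.
    + apply Hnot, Hand; [auto|apply Hnot; auto].
  - apply Hext with (fun l => ~ exists a, ~ sat M s (scons a (extend l e)) p).
    + intro l; split; [|firstorder].
      intros H a; apply NNPP; eauto.
    + apply Hnot, Hex.
      destruct (Hnot (S k) _ (IH s e (S k))) as [X HX].
      exists X; intros a l Hl; apply (HX (a :: l)); simpl; congruence.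
  - apply Hex; destruct (IH s e (S k)) as [X HX].
    exists X; intros a l Hl; apply (HX (a :: l)); simpl; congruence.
Qed.

Lemma arithmetical_comprehension_of_projections :
  projections_exist -> arithmetical_comprehension M.
Proof.
  intros HP p s e.
  destruct (arithmetical_tuples_comp HP p s e 1) as [X HX].
  (* The one-entry tuple of [n] has code [pair n zero]. *)
  destruct (Delta00_comp0 (fun _ => X) (fun n => pair n zero ∈ X)) as [Y HY].
  { delta00. }
  exists Y; intro n; rewrite HY; apply (HX (n :: nil) eq_refl).
Qed.

(** * Passing to unique witnesses *)

Lemma least_witness (A : numset M) n s :
  pair s n ∈ A ->
  exists t, pair t n ∈ A /\ forall u, u ≺ t -> pair u n ∉ A.
Proof.
  pose proof (RCA0_basic HM) as B; intro Hs.
  (* A bounded form of the least number principle, so that Delta00 induction on [k] suffices. *)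
  assert (H : forall k, (exists t, t ≺ k /\ pair t n ∈ A) ->
    exists t, t ≺ k /\ (pair t n ∈ A /\ forall u, u ≺ t -> pair u n ∉ A)).
  { apply (Delta00_ind (fun _ => A) (fun _ => n)
      (fun k e => (exists t, t ≺ k /\ pair t (e 0) ∈ A) ->
         exists t, t ≺ k /\ (pair t (e 0) ∈ A /\ forall u, u ≺ t -> pair u (e 0) ∉ A))).
    - delta00.
    - intros [t [Ht _]]; now apply (lt_0 B) in Ht.
    - intros k IH [t [Ht HA]].
      destruct (classic (exists t, t ≺ k /\ pair t n ∈ A)) as [E|E].
      + destruct (IH E) as [t' [Ht' H]]; exists t'; split; auto.
        apply (lt_succ B); auto.
      + exists t; repeat split; auto.
        intros u Hu HuA; apply E; exists u; split; auto.
        apply (lt_le_trans _ _ _ Hu Ht). }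
  destruct (H (s ⊕ one)) as [t [_ Ht]]; [|now exists t].
  exists s; split; [apply le_refl|exact Hs].
Qed.

(** Being a least witness is a bounded condition, so the uniqueness assumed for the coding space
    costs no generality. *)
Lemma least_witnesses_comp (A : numset M) :
  exists A' : numset M,
    (forall s t n, pair s n ∈ A' -> pair t n ∈ A' -> s = t) /\
    (forall n, (exists s, pair s n ∈ A') <-> exists s, pair s n ∈ A).
Proof.
  destruct (binary_comp (fun _ => A)
    (fun s n => pair s n ∈ A /\ forall u, u ≺ s -> pair u n ∉ A)) as [A' [HA' _]].
  { intros i j; delta00. }
  exists A'; split.
  - intros s t n Hs Ht; apply HA' in Hs as [Hs Ls]; apply HA' in Ht as [Ht Lt].
    destruct (lt_total s t) as [H|[H|H]]; [|easy|].
    + now apply Lt in H.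
    + now apply Ls in H.
  - intro n; split; intros [s Hs].
    + exists s; now apply HA' in Hs.
    + destruct (least_witness A n s Hs) as [t Ht]; exists t; now apply HA'.
Qed.

(** * The coding space *)

Definition pt_x (n : number M) : number M := pair zero n.
Definition pt_z (n m i : number M) : number M := pair one (triple n m i).
(** Storing the witness [s] in the point is what later makes separating neighbourhoods computable
    from the points alone. *)
Definition pt_y (n s i : number M) : number M := pair (one ⊕ one) (triple n s i).

Lemma zero_neq_one : (zero : number M) <> one.
Proof.
  intro E; apply (succ_neq0 (RCA0_basic HM) zero); now rewrite add_0_l.
Qed.

Lemma one_neq_two : (one : number M) <> one ⊕ one.
Proof.
  intro E; apply zero_neq_one, (succ_inj (RCA0_basic HM)); now rewrite add_0_l.
Qed.

Lemma zero_neq_two : (zero : number M) <> one ⊕ one.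
Proof. intro E; now apply (succ_neq0 (RCA0_basic HM) one). Qed.

Lemma triple_inj (a b c a' b' c' : number M) :
  triple a b c = triple a' b' c' -> a = a' /\ b = b' /\ c = c'.
Proof.
  intro E; apply pair_inj in E as [E ->]; now apply pair_inj in E as [-> ->].
Qed.

Lemma pt_x_inj n n' : pt_x n = pt_x n' -> n = n'.
Proof. intro E; now apply pair_inj in E as [_ E]. Qed.

Lemma pt_y_inj n s i n' s' i' :
  pt_y n s i = pt_y n' s' i' -> n = n' /\ s = s' /\ i = i'.
Proof. intro E; apply pair_inj in E as [_ E]; now apply triple_inj in E. Qed.

Lemma pt_z_inj n m i n' m' i' :
  pt_z n m i = pt_z n' m' i' -> n = n' /\ m = m' /\ i = i'.
Proof. intro E; apply pair_inj in E as [_ E]; now apply triple_inj in E. Qed.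

Lemma pt_x_neq_z n n' m i : pt_x n <> pt_z n' m i.
Proof. intro E; apply pair_inj in E as [E _]; now apply zero_neq_one in E. Qed.

Lemma pt_x_neq_y n n' s i : pt_x n <> pt_y n' s i.
Proof. intro E; apply pair_inj in E as [E _]; now apply zero_neq_two in E. Qed.

Lemma pt_z_neq_y n m i n' s i' : pt_z n m i <> pt_y n' s i'.
Proof. intro E; apply pair_inj in E as [E _]; now apply one_neq_two in E. Qed.

Lemma le_triple (a b c : number M) :
  a ≺ triple a b c ⊕ one /\ b ≺ triple a b c ⊕ one /\ c ≺ triple a b c ⊕ one.
Proof.
  unfold triple; repeat split.
  - eapply le_trans; apply le_pair_l.
  - eapply le_trans; [apply le_pair_r|apply le_pair_l].
  - apply le_pair_r.
Qed.

Lemma le_pair_triple (t a b c : number M) :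
  a ≺ pair t (triple a b c) ⊕ one /\ b ≺ pair t (triple a b c) ⊕ one /\
  c ≺ pair t (triple a b c) ⊕ one.
Proof.
  destruct (le_triple a b c) as (Ha & Hb & Hc).
  repeat split; eapply le_trans; eauto using le_pair_r.
Qed.

Section Space.
Context (A : numset M) (A_unique : forall s t n, pair s n ∈ A -> pair t n ∈ A -> s = t).

(** [pt_z n m i] converges to [pt_x n] as long as no witness for [n] has shown
    up; the witness [s] isolates [pt_x n] and creates the limits [pt_y n s i]. *)
Definition attached (p j q : number M) : Prop :=
  exists n m i, q = pt_z n m i /\ j ≺ m ⊕ one /\
    ((p = pt_x n /\ forall t, t ≺ j -> pair t n ∉ A) \/
     exists s, p = pt_y n s i /\ pair s n ∈ A).

Definition nbhd (p j q : number M) : Prop := q = p \/ attached p j q.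

(** The components of an attached point are bounded by its own code, and the witness in [pt_y n s i]
    by the code of the centre. *)
Lemma nbhd_definable s a b c :
  (exists k, s k = A) -> Delta00 s (fun e => nbhd (e a) (e b) (e c)).
Proof.
  intro HA.
  apply Delta00_ext with (fun e => e c = e a \/
    exists n, n ≺ e c ⊕ one /\ exists m, m ≺ e c ⊕ one /\ exists i, i ≺ e c ⊕ one /\
      (e c = pt_z n m i /\ e b ≺ m ⊕ one /\
       ((e a = pt_x n /\ forall t, t ≺ e b -> pair t n ∉ A) \/
        exists s, s ≺ e a ⊕ one /\ (e a = pt_y n s i /\ pair s n ∈ A)))).
  - intro e; split; (intros [H|H]; [now left|right]).
    + destruct H as (n & _ & m & _ & i & _ & Ec & Hm & H).
      exists n, m, i; repeat split; auto.
      destruct H as [H|(t & _ & H)]; eauto.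
    + destruct H as (n & m & i & Ec & Hm & H).
      destruct (le_pair_triple one n m i) as (Ln & Lm & Li).
      fold (pt_z n m i) in Ln, Lm, Li; rewrite <- Ec in Ln, Lm, Li.
      exists n; split; [exact Ln|]; exists m; split; [exact Lm|].
      exists i; split; [exact Li|]; repeat split; auto.
      destruct H as [H|(t & Ea & H)]; [now left|right].
      exists t; repeat split; auto; rewrite Ea; apply le_pair_triple.
  - unfold pt_x, pt_y, pt_z; delta00.
Qed.

Lemma attached_z p j q : attached p j q -> exists n m i, q = pt_z n m i.
Proof. intros (n & m & i & E & _); eauto. Qed.

Lemma attached_not_x p j n : ~ attached p j (pt_x n).
Proof. intro H; apply attached_z in H as (? & ? & ? & E); now apply pt_x_neq_z in E. Qed.

Lemma attached_not_y p j n s i : ~ attached p j (pt_y n s i).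
Proof.
  intro H; apply attached_z in H as (? & ? & ? & E); symmetry in E.
  now apply pt_z_neq_y in E.
Qed.

(** Only points [pt_z] are attached to others, and nothing is attached to them. Hence limit points
    are approached by isolated points only, which gives scatteredness. *)
Lemma attached_isolated p j q k r : attached p j q -> ~ attached q k r.
Proof.
  intros Hq (n & m & i & _ & _ & [[-> _]|(s & -> & _)]).
  - now apply attached_not_x in Hq.
  - now apply attached_not_y in Hq.
Qed.

Lemma attached_le p j q : attached p j q -> j ≺ q ⊕ one.
Proof.
  intros (n & m & i & -> & Hj & _).
  eapply le_trans; [exact Hj|apply le_pair_triple].
Qed.

Lemma attached_mono p j j' q : j' ≺ j ⊕ one -> attached p j q -> attached p j' q.
Proof.
  intros Hj (n & m & i & E & Hm & H); exists n, m, i; repeat split; auto.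
  - eapply le_trans; eauto.
  - destruct H as [[Ep H]|H]; [left|now right]; split; [exact Ep|].
    intros t Ht; apply H; eapply lt_le_trans; eauto.
Qed.

Lemma nbhd_mono p j j' q : j' ≺ j ⊕ one -> nbhd p j q -> nbhd p j' q.
Proof. intros Hj [H|H]; [now left|right; eapply attached_mono; eauto]. Qed.

(** The shared point determines [n] and [i], and two centres [pt_y] over the same [n] and [i]
    coincide by uniqueness of witnesses. So one centre is [pt_x n], which keeps its attached points
    only for indices up to the witness. *)
Lemma attached_clash p j q k z :
  attached p j z -> attached q k z -> p <> q ->
  (exists n s i, p = pt_x n /\ q = pt_y n s i /\ pair s n ∈ A /\ j ≺ s ⊕ one) \/
  (exists n s i, q = pt_x n /\ p = pt_y n s i /\ pair s n ∈ A /\ k ≺ s ⊕ one).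
Proof.
  intros (n & m & i & -> & _ & Hp) (n' & m' & i' & E & _ & Hq) Hpq.
  apply pt_z_inj in E as (<- & <- & <-).
  destruct Hp as [[-> Hp]|(s & -> & Hs)], Hq as [[-> Hq]|(s' & -> & Hs')].
  - easy.
  - left; exists n, s', i; repeat split; auto.
    apply not_lt; intro H; now apply Hp in H.
  - right; exists n, s, i; repeat split; auto.
    apply not_lt; intro H; now apply Hq in H.
  - now rewrite (A_unique _ _ _ Hs Hs') in Hpq.
Qed.

Lemma lt_not_le (m n : number M) : m ≺ n -> ~ n ≺ m ⊕ one.
Proof. intros H H'; now apply not_lt in H'. Qed.

(** If one centre is attached to the other, [attached_le] contradicts the bounds. Otherwise
    [attached_clash] bounds an index by [s], which is at most the code of [pt_y n s i]. *)
Lemma nbhd_disjoint p q j k z :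
  p <> q -> q ≺ j -> p ≺ k -> nbhd p j z -> nbhd q k z -> False.
Proof.
  intros Hpq Hj Hk [-> |Hp] [E|Hq].
  - easy.
  - apply attached_le in Hq; exact (lt_not_le _ _ Hk Hq).
  - subst; apply attached_le in Hp; exact (lt_not_le _ _ Hj Hp).
  - destruct (attached_clash _ _ _ _ _ Hp Hq Hpq)
      as [(n & s & i & -> & -> & _ & H)|(n & s & i & -> & -> & _ & H)].
    + apply (lt_not_le _ _ Hj); eapply le_trans; [exact H|apply le_pair_triple].
    + apply (lt_not_le _ _ Hk); eapply le_trans; [exact H|apply le_pair_triple].
Qed.

(** The neighbourhoods of [pt_x n] are not closed while [j ≺ s ⊕ one] for the
    witness [s] of [n], but they are closed from then on. *)
Lemma nbhd_closed p :
  exists j, forall j', j ≺ j' ⊕ one -> forall q, ~ nbhd p j' q ->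
    forall z, nbhd p j' z -> nbhd q (p ⊕ one) z -> False.
Proof.
  (* Whether [n] has a witness is decided classically; regularity asks for the existence of open
     sets, not for a computed index. *)
  assert (Hj : exists j, forall n s, p = pt_x n -> pair s n ∈ A -> s ≺ j).
  { destruct (classic (exists n s, p = pt_x n /\ pair s n ∈ A)) as [(n & s & -> & Hs)|H].
    - exists (s ⊕ one); intros n' s' E Hs'; apply pt_x_inj in E as <-.
      rewrite (A_unique _ _ _ Hs' Hs); apply le_refl.
    - exists zero; intros n s E Hs; destruct H; eauto. }
  destruct Hj as [j Hj]; exists j; intros j' Hj' q Hq z Hz Hz'.
  assert (Hpq : p <> q) by (intros ->; apply Hq; now left).
  destruct Hz as [-> |Hz], Hz' as [E|Hz'].
  - easy.
  - apply attached_le in Hz'; apply (lt_not_le _ _ (le_refl p) Hz').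
  - subst; apply Hq; now right.
  - destruct (attached_clash _ _ _ _ _ Hz Hz' Hpq)
      as [(n & s & i & -> & -> & Hs & H)|(n & s & i & -> & -> & Hs & H)].
    + apply (lt_not_le s j'); [|exact H].
      eapply lt_le_trans; [apply (Hj n s eq_refl Hs)|exact Hj'].
    (* Now [p] is [pt_y n s i], and the index [p ⊕ one] would be at most [s], although [s] is at
       most the code [p]. *)
    + apply (lt_not_le _ _ (le_refl (pt_y n s i))).
      eapply le_trans; [exact H|apply le_pair_triple].
Qed.

(** Numbers outside the three families, and [pt_y n s i] without [pair s n ∈ A], are kept as
    isolated points, so that every number is a point. The value of [kfun] recentres at the common
    point [x], with an index at least as large as both given ones. *)
Definition coding_space (C : CSC_data M) : Prop :=
  (forall x, x ∈ points C) /\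
  (forall x i, U C i x <-> exists p j, i = pair p j /\ nbhd p j x) /\
  (forall c, c ∈ kfun C <-> exists x p a q b,
     c = pair (triple x (pair p a) (pair q b)) (pair x (a ⊕ b))).

Lemma coding_space_exists : exists C, coding_space C.
Proof.
  destruct everything_comp as [X HX].
  destruct (binary_comp (fun _ => A) (fun x i => exists p, p ≺ i ⊕ one /\
     exists j, j ≺ i ⊕ one /\ (i = pair p j /\ nbhd p j x))) as [B [HB _]].
  { intros i j; delta00; apply nbhd_definable; now exists 0. }
  destruct (binary_comp (fun _ => X) (fun u m =>
     exists x, x ≺ u ⊕ one /\ exists i, i ≺ u ⊕ one /\ exists j, j ≺ u ⊕ one /\
     exists p, p ≺ i ⊕ one /\ exists a, a ≺ i ⊕ one /\
     exists q, q ≺ j ⊕ one /\ exists b, b ≺ j ⊕ one /\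
       (i = pair p a /\ j = pair q b /\ u = triple x i j /\ m = pair x (a ⊕ b))))
    as [K [HK HK']].
  { intros i j; delta00. }
  exists {| points := X; basis := B; kfun := K |}; repeat split; simpl; auto.
  - intro H; apply HB in H as (p & _ & j & _ & H); eauto.
  - intros (p & j & -> & H); apply HB.
    exists p; split; [apply le_pair_l|]; exists j; split; [apply le_pair_r|auto].
  - intro H; destruct (HK' c H) as (u & m & ->); apply HK in H
      as (x & _ & i & _ & j & _ & p & _ & a & _ & q & _ & b & _ & -> & -> & -> & ->).
    now exists x, p, a, q, b.
  - intros (x & p & a & q & b & ->); apply HK.
    destruct (le_triple x (pair p a) (pair q b)) as (Lx & Lp & Lq).
    exists x; split; [exact Lx|]; exists (pair p a); split; [exact Lp|].
    exists (pair q b); split; [exact Lq|].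
    exists p; split; [apply le_pair_l|]; exists a; split; [apply le_pair_r|].
    exists q; split; [apply le_pair_l|]; exists b; split; [apply le_pair_r|].
    auto.
Qed.

Context (C : CSC_data M) (HC : coding_space C).

Lemma in_points x : x ∈ points C.
Proof. apply HC. Qed.

Lemma U_pair p j x : U C (pair p j) x <-> nbhd p j x.
Proof.
  destruct HC as (_ & HU & _); rewrite HU; split; [|eauto].
  intros (p' & j' & E & H); now apply pair_inj in E as [<- <-].
Qed.

Lemma U_inv i x : U C i x -> exists p j, i = pair p j /\ nbhd p j x.
Proof. apply HC. Qed.

Lemma kfun_spec c : c ∈ kfun C <-> exists x p a q b,
     c = pair (triple x (pair p a) (pair q b)) (pair x (a ⊕ b)).
Proof. apply HC. Qed.

(* Either [x = p], or [x] is isolated and its neighbourhoods are singletons. *)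
Lemma nbhd_centred p a x j :
  nbhd p a x -> a ≺ j ⊕ one -> forall z, nbhd x j z -> nbhd p a z.
Proof.
  intros [-> |Hx] Hj z Hz.
  - now apply nbhd_mono with j.
  - destruct Hz as [-> |Hz]; [now right|].
    now apply (attached_isolated _ _ _ _ _ Hx) in Hz.
Qed.

Lemma coding_space_CSC : is_CSC C.
Proof.
  constructor.
  - intros; apply in_points.
  - intros x _; exists (pair x zero); apply U_pair; now left.
  - split.
    + intros c Hc; apply kfun_spec in Hc as (x & p & a & q & b & ->).
      exists (triple x (pair p a) (pair q b)), (pair x (a ⊕ b)).
      split; [|split; [exact I|reflexivity]].
      exists (pair x (pair p a)), (pair q b).
      split; [|split; [exact I|reflexivity]].
      exists x, (pair p a).
      split; [apply in_points|split; [exact I|reflexivity]].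
    + intros c y z Hy Hz.
      apply kfun_spec in Hy as (x & p & a & q & b & E).
      apply kfun_spec in Hz as (x' & p' & a' & q' & b' & E').
      apply pair_inj in E as [-> ->]; apply pair_inj in E' as [E ->].
      apply triple_inj in E as (-> & E1 & E2).
      apply pair_inj in E1 as [_ ->]; apply pair_inj in E2 as [_ ->]; auto.
  - intros x i j Hi Hj.
    apply U_inv in Hi as (p & a & -> & Hp); apply U_inv in Hj as (q & b & -> & Hq).
    exists (pair x (a ⊕ b)); split; [|split].
    + apply kfun_spec; now exists x, p, a, q, b.
    + apply U_pair; now left.
    + intros z Hz; apply U_pair in Hz; split; apply U_pair.
      * apply (nbhd_centred _ _ _ _ Hp (le_add_l a b) _ Hz).
      * apply (nbhd_centred _ _ _ _ Hq (le_add_r a b) _ Hz).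
Qed.

(** A point of [Y] attached to [y] is isolated in the whole space. If there is none, the
    neighbourhood of [y] with index [zero] meets [Y] only in [y]. *)
Lemma coding_space_scattered : scattered C.
Proof.
  intros Y _ [y Hy].
  assert (Hiso : forall q, q ∈ Y -> (forall z, nbhd q zero z -> z ∈ Y -> z = q) ->
                 exists y, isolated_in C Y y).
  { intros q Hq H; exists q; split; [exact Hq|].
    intros x ->; exists (pair q zero); unfold subspace_basis; split.
    - split; [apply U_pair; now left|exact Hq].
    - intros z [Hz HzY]; apply U_pair in Hz; auto. }
  destruct (classic (exists q, q ∈ Y /\ attached y zero q)) as [[q [Hq Hyq]]|H].
  - apply (Hiso q Hq); intros z [Hz|Hz] _; [exact Hz|].
    now apply (attached_isolated _ _ _ _ _ Hyq) in Hz.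
  - apply (Hiso y Hy); intros z [Hz|Hz] HzY; [exact Hz|].
    destruct H; eauto.
Qed.

(** Strictly above both codes, as [nbhd_disjoint] demands. *)
Definition separation (p q : number M) : number M := p ⊕ q ⊕ one.

Lemma nbhd_separation p q z :
  p <> q -> nbhd p (separation p q) z -> nbhd q (separation p q) z -> False.
Proof. intro H; apply nbhd_disjoint; auto; [apply le_add_r|apply le_add_l]. Qed.

Lemma binary_function_comp (g : number M -> number M -> number M) :
  (forall i j, definable_term (fun e => g (e i) (e j))) ->
  exists H : numset M,
    function (product (members (points C)) (members (points C))) everything H /\
    forall x y i, maps H (pair x y) i <-> i = g x y.
Proof.
  intro Hg.
  destruct (binary_comp (fun _ => A) (fun u i => exists x, x ≺ u ⊕ one /\
    exists y, y ≺ u ⊕ one /\ (u = pair x y /\ i = g x y))) as [H [HH HH']].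
  { intros i j; delta00. }
  assert (E : forall x y i, maps H (pair x y) i <-> i = g x y).
  { intros x y i; unfold maps; rewrite HH; split.
    - intros (x' & _ & y' & _ & E & ->); now apply pair_inj in E as [-> ->].
    - intros ->; exists x; split; [apply le_pair_l|].
      exists y; split; [apply le_pair_r|auto]. }
  exists H; split; [|exact E]; split; [split|].
  - intros c Hc; destruct (HH' c Hc) as (u & i & ->).
    apply HH in Hc as (x & _ & y & _ & -> & _).
    exists (pair x y), i; repeat split; exists x, y; repeat split; apply in_points.
  - intros u i j Hi Hj.
    assert (Hu : exists x y, u = pair x y).
    { apply HH in Hi as (x & _ & y & _ & -> & _); eauto. }
    destruct Hu as (x & y & ->); apply E in Hi as ->; now apply E in Hj.
  - intros u (x & y & _ & _ & ->); exists (g x y); now apply E.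
Qed.

Lemma coding_space_eT2 : eT2 C.
Proof.
  destruct (binary_function_comp (fun p q => pair p (separation p q))) as [H0 [F0 E0]].
  { intros i j; unfold separation; definable_term. }
  destruct (binary_function_comp (fun p q => pair q (separation p q))) as [H1 [F1 E1]].
  { intros i j; unfold separation; definable_term. }
  exists H0, H1; split; [exact F0|split; [exact F1|]].
  intros x y _ _ Hxy i j Hi Hj; apply E0 in Hi as ->; apply E1 in Hj as ->.
  rewrite !U_pair; split; [now left|split; [now left|]].
  intros [z [Hz Hz']]; apply U_pair in Hz, Hz'; now apply (nbhd_separation x y z).
Qed.

Lemma U_comp i : exists V : numset M, forall z, z ∈ V <-> U C i z.
Proof.
  destruct (Delta00_comp (fun _ => basis C) (fun _ => i)
              (fun z e => pair z (e 0) ∈ basis C)) as [V HV].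
  { delta00. }
  exists V; exact HV.
Qed.

Lemma U_open V i : (forall z, z ∈ V <-> U C i z) -> open_set C V.
Proof.
  intro HV; split; [intros; apply in_points|].
  intros x Hx; exists i; split; [now apply HV|].
  intros z Hz; now apply HV.
Qed.

Lemma coding_space_T0 : T0 C.
Proof.
  intros x y _ _ Hxy.
  destruct (U_comp (pair x (separation x y))) as [V HV].
  exists V; split; [eapply U_open, HV|].
  left; rewrite !HV, !U_pair; split; [now left|].
  intro Hy; apply (nbhd_separation x y y Hxy Hy); now left.
Qed.

(** By [nbhd_closed] the neighbourhoods of [x] are clopen from some index on. Take for [V] the one
    with index [a ⊕ j], which also lies in [nbhd p a], and for [W] its complement. *)
Lemma coding_space_regular : regular C.
Proof.
  intros x i Hi; apply U_inv in Hi as (p & a & -> & Hp).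
  destruct (nbhd_closed x) as [j Hj].
  specialize (Hj (a ⊕ j) (le_add_r a j)).
  destruct (U_comp (pair x (a ⊕ j))) as [V HV].
  destruct (complement_comp V) as [W HW].
  exists V, W; repeat split.
  - intros; apply in_points.
  - eapply U_open, HV.
  - intros; apply in_points.
  - intros q Hq; apply HW in Hq; rewrite HV, U_pair in Hq.
    exists (pair q (x ⊕ one)); split; [apply U_pair; now left|].
    intros z Hz; apply HW; rewrite HV, U_pair.
    apply U_pair in Hz; intro H; now apply (Hj q Hq z).
  - apply HV, U_pair; now left.
  - apply in_points.
  - now rewrite HW.
  - intros z _ Hz; rewrite HW in Hz; apply NNPP in Hz.
    rewrite HV, U_pair in Hz; apply U_pair.
    apply (nbhd_centred _ _ _ _ Hp (le_add_l a j) _ Hz).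
Qed.

(** * Endpoints, intervals and the order topology *)

Lemma fin_inj (a b : number M) : fin a = fin b -> a = b.
Proof. intro E; now apply (succ_inj (RCA0_basic HM)), (succ_inj (RCA0_basic HM)). Qed.

Lemma fin_neq_minus_infty (a : number M) : fin a <> minus_infty.
Proof. apply (succ_neq0 (RCA0_basic HM)). Qed.

Lemma fin_neq_plus_infty (a : number M) : fin a <> plus_infty.
Proof.
  intro E; apply (succ_neq0 (RCA0_basic HM) a), (succ_inj (RCA0_basic HM)).
  now rewrite add_0_l.
Qed.

Lemma minus_neq_plus_infty : (minus_infty : number M) <> plus_infty.
Proof. apply zero_neq_one. Qed.

Section Order.
Context (L R : numset M) (HL : linear_order L R).

Lemma ext_lt_fin a b : ext_lt L R (fin a) (fin b) <-> pair a b ∈ R.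
Proof.
  split.
  - intros [[E _]|[[E _]|[[_ E]|(a' & b' & H & Ea & Eb)]]].
    + now apply fin_neq_minus_infty in E.
    + now apply fin_neq_minus_infty in E.
    + now apply fin_neq_plus_infty in E.
    + apply fin_inj in Ea as ->; apply fin_inj in Eb as ->; exact H.
  - intro H; right; right; right; exists a, b; auto.
Qed.

Lemma minus_infty_lt b : b ∈ L -> ext_lt L R minus_infty (fin b).
Proof. intro Hb; right; left; split; eauto. Qed.

Lemma lt_plus_infty a : a ∈ L -> ext_lt L R (fin a) plus_infty.
Proof. intro Ha; right; right; left; split; eauto. Qed.

Lemma not_plus_infty_lt b : ~ ext_lt L R plus_infty (fin b).
Proof.
  intros [[E _]|[[E _]|[[(a & _ & E) _]|(a & _ & _ & E & _)]]].
  - now apply minus_neq_plus_infty.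
  - now apply minus_neq_plus_infty.
  - symmetry in E; now apply fin_neq_plus_infty in E.
  - symmetry in E; now apply fin_neq_plus_infty in E.
Qed.

Lemma not_lt_minus_infty a : ~ ext_lt L R (fin a) minus_infty.
Proof.
  intros [[_ E]|[[_ (b & _ & E)]|[[_ E]|(_ & b & _ & _ & E)]]].
  - now apply minus_neq_plus_infty.
  - symmetry in E; now apply fin_neq_minus_infty in E.
  - now apply minus_neq_plus_infty.
  - symmetry in E; now apply fin_neq_minus_infty in E.
Qed.

Lemma linear_order_asym a b : pair a b ∈ R -> pair b a ∉ R.
Proof.
  intros H H'; apply (lo_irrefl HL a); eapply (lo_trans HL); eauto.
Qed.

(** A point outside the interval that is no endpoint lies strictly beyond one of them, and the open
    ray from that endpoint misses the interval. The point [y] excludes the degenerate cases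
    [a = plus_infty] and [b = minus_infty]. *)
Lemma interval_closure a b y u :
  endpoint L a -> endpoint L b -> interval L R a b y ->
  u ∈ L -> ~ interval L R a b u -> a <> fin u -> b <> fin u ->
  exists c d, endpoint L c /\ endpoint L d /\ interval L R c d u /\
    forall w, interval L R a b w -> ~ interval L R c d w.
Proof.
  intros Ha Hb (_ & Hay & Hyb) Hu Hab Na Nb.
  destruct (classic (ext_lt L R a (fin u))) as [Hau|Hau].
  - assert (Hub : ~ ext_lt L R (fin u) b) by (intro H; now apply Hab).
    destruct Hb as [-> |[-> |(b' & Hb & ->)]].
    + now apply not_lt_minus_infty in Hyb.
    + destruct Hub; now apply lt_plus_infty.
    + exists (fin b'), plus_infty; repeat split.
      * right; right; eauto.
      * right; left; auto.
      * exact Hu.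
      * apply ext_lt_fin; rewrite ext_lt_fin in Hub.
        destruct (lo_total HL _ _ Hb Hu) as [H|[-> |H]]; easy.
      * now apply lt_plus_infty.
      * intros w (_ & _ & H) (_ & H' & _).
        rewrite ext_lt_fin in H, H'; now apply linear_order_asym in H.
  - destruct Ha as [-> |[-> |(a' & Ha & ->)]].
    + destruct Hau; now apply minus_infty_lt.
    + now apply not_plus_infty_lt in Hay.
    + exists minus_infty, (fin a'); repeat split.
      * left; auto.
      * right; right; eauto.
      * exact Hu.
      * now apply minus_infty_lt.
      * apply ext_lt_fin; rewrite ext_lt_fin in Hau.
        destruct (lo_total HL _ _ Ha Hu) as [H|[-> |H]]; easy.
      * intros w (_ & H & _) (_ & _ & H').
        rewrite ext_lt_fin in H, H'; now apply linear_order_asym in H.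
Qed.

Context (D : CSC_data M) (HD : order_topology L R D).

Lemma U_order_topology w y :
  U D w y <-> exists a b, endpoint L a /\ endpoint L b /\ interval L R a b y /\
                          w = pair a b.
Proof.
  unfold U; rewrite (ot_basis HD); split.
  - intros (z & a & b & Ha & Hb & Hz & E); apply pair_inj in E as [-> ->].
    now exists a, b.
  - intros (a & b & Ha & Hb & Hy & ->); now exists y, a, b.
Qed.

Lemma U_interval a b y :
  endpoint L a -> endpoint L b -> U D (pair a b) y <-> interval L R a b y.
Proof.
  intros Ha Hb; rewrite U_order_topology; split.
  - intros (a' & b' & _ & _ & H & E); now apply pair_inj in E as [-> ->].
  - intro H; now exists a, b.
Qed.

(** * Bounding witnesses by the moduli of an embedding *)

Context (f v v' : numset M).
Context (Hf : function (members (points C)) (members (points D)) f).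
Context (Fv' : function (product (members (points C)) everything) everything v').
Context (Hv' : forall x y j, maps f x y -> U D j y -> forall i, maps v' (pair x j) i ->
                 U C i x /\ (forall z w, U C i z -> maps f z w -> U D j w)).
Context (Fv : function (product (members (points C)) everything) everything v).
Context (Hv : forall x i, U C i x -> forall j, maps v (pair x i) j ->
                (exists y, maps f x y /\ U D j y) /\
                (forall z w, maps f z w -> U D j w -> U C i z)).

Lemma f_total x : exists y, maps f x y /\ y ∈ L.
Proof.
  destruct Hf as [[Hsub _] Htot]; destruct (Htot x (in_points x)) as [y Hy].
  exists y; split; [exact Hy|].
  destruct (Hsub _ Hy) as (x' & y' & _ & H & E); apply pair_inj in E as [_ ->].
  now apply (ot_points HD).
Qed.

Lemma modulus_total g x i :
  function (product (members (points C)) everything) everything g ->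
  exists j, maps g (pair x i) j.
Proof.
  intros [_ Htot]; apply Htot; exists x, i; repeat split; apply in_points.
Qed.

(** The modulus [v] pulls an interval around the image back into a neighbourhood of [pt_y n s i],
    which contains no other point of the form [pt_y]. *)
Lemma f_inj_pt_y n s i n' s' i' u :
  maps f (pt_y n s i) u -> maps f (pt_y n' s' i') u -> i' = i.
Proof.
  intros H H'.
  assert (Hi : U C (pair (pt_y n s i) zero) (pt_y n s i)) by (apply U_pair; now left).
  destruct (modulus_total v (pt_y n s i) (pair (pt_y n s i) zero) Fv) as [j Hj].
  destruct (Hv _ _ Hi _ Hj) as [(y & Hy & Hyj) Hback].
  destruct Hf as [[_ Huniq] _]; rewrite (Huniq _ _ _ H Hy) in H'.
  apply (Hback _ _ H'), U_pair in Hyj as [E|E].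
  - now apply pt_y_inj in E.
  - now apply attached_not_y in E.
Qed.

Lemma witness_bound n s w j :
  pair s n ∈ A ->
  maps v (pair (pt_x n) (pair (pt_x n) zero)) w -> maps v' (pair (pt_x n) w) j ->
  s ≺ j ⊕ one.
Proof.
  intros Hs Hw Hj.
  assert (Hx : U C (pair (pt_x n) zero) (pt_x n)) by (apply U_pair; now left).
  destruct (Hv _ _ Hx _ Hw) as [(y & Hy & Hyw) Hback].
  destruct (Hv' _ _ _ Hy Hyw _ Hj) as [Hxj Hfwd].
  apply U_order_topology in Hyw as (a & b & Ha & Hb & Hab & ->).
  (* Since [pt_x n] is attached to nothing, the neighbourhood given by [v'] is centred at [pt_x n]
     itself. *)
  apply U_inv in Hxj as (p & j' & -> & [<- |Hp]);
    [|now apply attached_not_x in Hp].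
  eapply le_trans; [|apply le_pair_r].
  destruct (classic (s ≺ j' ⊕ one)) as [H|H]; [exact H|exfalso].
  (* The neighbourhood of [pt_x n] has thus not yet shrunk at index [j']. *)
  assert (Hbefore : forall t, t ≺ j' -> pair t n ∉ A).
  { intros t Ht HtA; rewrite (A_unique _ _ _ HtA Hs) in Ht.
    apply H, (lt_succ (RCA0_basic HM)); auto. }
  assert (Hend : forall i, exists u, maps f (pt_y n s i) u /\ (a = fin u \/ b = fin u)).
  { intro i; destruct (f_total (pt_y n s i)) as [u [Hu HuL]].
    exists u; split; [exact Hu|apply NNPP; intro Hne].
    destruct (interval_closure a b y u) as (c & d & Hc & Hd & Hcd & Hdisj); auto.
    - intro Hu'; apply (U_interval _ _ _ Ha Hb), (Hback _ _ Hu) in Hu'.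
      apply U_pair in Hu' as [E|E]; [|now apply attached_not_y in E].
      symmetry in E; now apply pt_x_neq_y in E.
    - destruct (modulus_total v' (pt_y n s i) (pair c d) Fv') as [k Hk].
      apply (U_interval _ _ _ Hc Hd) in Hcd.
      destruct (Hv' _ _ _ Hu Hcd _ Hk) as [Hyk Hfwd'].
      apply U_inv in Hyk as (q & k' & -> & [<- |Hq]);
        [|now apply attached_not_y in Hq].
      (* The middle component [j' ⊕ k'] puts this point into both neighbourhoods, so its image would
         lie in two disjoint intervals. *)
      destruct (f_total (pt_z n (j' ⊕ k') i)) as [z [Hz _]].
      apply (Hdisj z).
      + apply (U_interval _ _ _ Ha Hb), (Hfwd _ _) with (2 := Hz).
        apply U_pair; right; exists n, (j' ⊕ k'), i; repeat split.
        * apply le_add_l.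
        * left; auto.
      + apply (U_interval _ _ _ Hc Hd), (Hfwd' _ _) with (2 := Hz).
        apply U_pair; right; exists n, (j' ⊕ k'), i; repeat split.
        * apply le_add_r.
        * right; eauto. }
  destruct (Hend zero) as (u0 & M0 & E0), (Hend one) as (u1 & M1 & E1),
    (Hend (one ⊕ one)) as (u2 & M2 & E2).
  assert (H01 : u0 <> u1).
  { intros ->; apply zero_neq_one; eapply f_inj_pt_y; eauto. }
  assert (H02 : u0 <> u2).
  { intros ->; apply zero_neq_two; eapply f_inj_pt_y; eauto. }
  assert (H12 : u1 <> u2).
  { intros ->; apply one_neq_two; eapply f_inj_pt_y; eauto. }
  (* Three distinct images cannot share the two endpoints [a] and [b]. *)
  destruct E0 as [-> | ->], E1 as [E1|E1], E2 as [E2|E2];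
    try (apply fin_inj in E1; congruence); try (apply fin_inj in E2; congruence);
    apply H12, fin_inj; congruence.
Qed.

Lemma projection_of_moduli : exists Y : numset M, forall n, n ∈ Y <-> exists s, pair s n ∈ A.
Proof.
  apply (Delta01_comp (scons A (scons v (fun _ => v'))) (fun _ => zero)
    (fun s n _ => pair s n ∈ A)
    (* A single universal quantifier [u] bounds both moduli values [w] and [j], which puts the
       condition into Pi01 form. *)
    (fun u n _ => forall w, w ≺ u ⊕ one -> forall j, j ≺ u ⊕ one ->
       (maps v (pair (pt_x n) (pair (pt_x n) zero)) w ->
        maps v' (pair (pt_x n) w) j -> exists s, s ≺ j ⊕ one /\ pair s n ∈ A))).
  - delta00.
  - unfold maps, pt_x; delta00.
  - intro n; split.
    + intros [s Hs] u w _ j _ Hw Hj; exists s; split; [|exact Hs].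
      eapply witness_bound; eauto.
    + intro H; destruct (modulus_total v (pt_x n) (pair (pt_x n) zero) Fv) as [w Hw].
      destruct (modulus_total v' (pt_x n) w Fv') as [j Hj].
      destruct (H (w ⊕ j) w (le_add_l w j) j (le_add_r w j) Hw Hj) as (s & _ & Hs).
      eauto.
Qed.

End Order.
End Space.
End Arithmetic.

(** Derivability over RCA_0 is expressed as truth in every (possibly
    nonstandard) L_2-structure satisfying RCA_0. *)
Theorem theorem4p22 (M : L2structure) (HM : RCA0 M)
  (Hembed : forall C : CSC_data M,
     is_CSC C -> scattered C -> eT2 C -> T3 C ->
     effectively_embeds_in_linear_order C) :
  arithmetical_comprehension M.
Proof.
  intros p s e.
  (* The set parameter [s 0] serves as the set [X0] that the arithmetic presupposes. *)
  apply (arithmetical_comprehension_of_projections HM (s 0)); intro A'.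
  destruct (least_witnesses_comp HM (s 0) A') as (A & A_unique & HA).
  destruct (coding_space_exists HM (s 0) A) as [C HC].
  destruct (Hembed C) as (L & R & D & f & HL & HD & Hf & (v' & Fv' & Hv') & v & Fv & Hv).
  - eapply coding_space_CSC; eauto.
  - eapply coding_space_scattered; eauto.
  - eapply coding_space_eT2; eauto.
  - split; [eapply coding_space_T0|eapply coding_space_regular]; eauto.
  - destruct (projection_of_moduli HM (s 0) A A_unique C HC L R HL D HD f v v'
                Hf Fv' Hv' Fv Hv) as [Y HY].
    exists Y; intro n; rewrite HY; apply HA.
Qed.
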